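(* Let $G$ be a simple graph. Then the maximum order of a connected component of $G$ equals $c:=\deg\bigl(da(G;x,1)\bigr)$ (degree as a polynomial in $x$). Further, the number of components of $G$ of this maximum order $c$ is $[x^{c}]\,da(G;x,1)$.
   Context: All graphs are finite, simple and have at least one vertex. For a graph $G$, $S\subseteq V(G)$ and $u\in V(G)$, let $\bar S=V(G)\setminus S$, let $\delta_S(u)=|\{v\in S:\{u,v\}\in E(G)\}|$, and let $G[S]$ be the subgraph induced by $S$. The defensive alliance polynomial of $G$ is $$da(G;x,y)=\sum_{S} x^{|S|}\,y^{f_y(S)},\qquad f_y(S)=\min_{u\in S}\bigl(\delta_S(u)-\delta_{\bar S}(u)+|V(G)|\bigr),$$ where the sum runs over all non-empty $S\subseteq V(G)$ such that $G[S]$ is connected (single-vertex graphs are connected). $[x^k]\,da(G;x,1)$ denotes the coefficient of $x^k$ in $da(G;x,1)$. *)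

(* Defs.v *)
From mathcomp Require Import all_boot all_order all_algebra.

Set Implicit Arguments.
Unset Strict Implicit.
Unset Printing Implicit Defensive.

Import GRing.Theory.
Local Open Scope ring_scope.

(* A graph with vertex type T is its adjacency relation e : rel T; it is simple *)
(* when e is symmetric and irreflexive.                                         *)

Definition connected_graph (T : finType) (e : rel T) : bool :=
  (0 < #|T|)%N && [forall u, forall v, connect e u v].

(* G[S], as a graph on the subtype of the vertices belonging to S. *)
Definition induced_graph (T : finType) (e : rel T) (S : {set T}) :
    rel {x : T | x \in S} :=
  [rel u v | e (val u) (val v)].
Arguments induced_graph {T} e S.

Definition components (T : finType) (e : rel T) : {set {set T}} :=
  equivalence_partition (connect e) [set: T].

Section DefensiveAlliance.

Variables (T : finType) (e : rel T).
Implicit Types (S : {set T}) (u : T).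

Definition deg_in S u : nat := #|[set v in S | e u v]|.

(* The additions are done first: since deg_in (~: S) u <= #|T|, the truncated   *)
(* subtraction of nat then agrees with integer subtraction.                     *)
Definition alliance_exponent S u : nat :=
  (deg_in S u + #|T| - deg_in (~: S) u)%N.

(* The default value 2 * #|T| bounds every alliance_exponent, so that this is   *)
(* the true minimum when S is non-empty; see f_yP.                              *)
Definition f_y S : nat :=
  \big[minn/(2 * #|T|)%N]_(u in S) alliance_exponent S u.

(* da(G; x, y) in Z[y][x]: the outer variable 'X is x, the constant 'X%:P is y. *)
Definition da : {poly {poly int}} :=
  \sum_(S : {set T} | (S != set0) && connected_graph (induced_graph e S))
    'X ^+ #|S| * 'X%:P ^+ f_y S.

(* da(G; x, 1) in Z[x]. *)
Definition da_x1 : {poly int} := map_poly (horner_eval 1) da.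

Lemma alliance_exponent_int S u :
  (alliance_exponent S u)%:Z =
    (deg_in S u)%:Z - (deg_in (~: S) u)%:Z + #|T|%:Z.
Proof.
have le_deg : (deg_in (~: S) u <= deg_in S u + #|T|)%N.
  by rewrite (leq_trans (max_card _)) // leq_addl.
by rewrite -subzn // PoszD addrAC.
Qed.

Lemma f_yP S : S != set0 ->
  (exists2 u, u \in S & f_y S = alliance_exponent S u) /\
  (forall u, u \in S -> f_y S <= alliance_exponent S u)%N.
Proof.
have f_y_le u : u \in S -> (f_y S <= alliance_exponent S u)%N.
  move=> uS; rewrite /f_y; have: u \in index_enum T by rewrite mem_index_enum.
  elim: (index_enum T) => [|v r IHr] //; rewrite inE big_cons.
  case/predU1P=> [<-|/IHr r_le]; first by rewrite uS geq_minl.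
  by case: ifP => // _; apply: leq_trans (geq_minr _ _) r_le.
case/set0Pn=> u0 u0S; split=> //.
have: f_y S = (2 * #|T|)%N \/ exists2 u, u \in S & f_y S = alliance_exponent S u.
  rewrite /f_y; elim/big_ind: _ => [|m n Hm Hn|u uS]; first by left.
    by case: (leqP m n).
  by right; exists u.
case=> // f_y_eq; exists u0 => //; apply/eqP.
rewrite eqn_leq f_y_le //= f_y_eq leq_subLR.
by rewrite (leq_trans (leq_add (max_card _) (leqnn _))) // mul2n -addnn leq_addl.
Qed.

End DefensiveAlliance.

(* Main.v *)
(** The connected vertex sets of [G] all lie inside a connected component, and
    the components are themselves connected.  Setting [y := 1] turns the
    coefficient of [x ^ k] into the number of connected sets of order [k]; for
    [k] the maximum order of a component these are exactly the components of
    order [k], and for larger [k] there are none. *)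
Require Import Defs.
From mathcomp Require Import all_boot all_order all_algebra.

Import GRing.Theory.
Local Open Scope ring_scope.

Definition connected_set {T : finType} (e : rel T) (S : {set T}) : bool :=
  (S != set0) && connected_graph (induced_graph e S).

Lemma coef_da_x1 {T : finType} (e : rel T) k :
  (da_x1 e)`_k = (#|[set S | connected_set e S & #|S| == k]|)%:Z.
Proof.
rewrite /da_x1 /da rmorph_sum coef_sum.
under eq_bigr => S _ do
  rewrite rmorphM !rmorphXn /= map_polyX map_polyC /= /horner_eval hornerX
          expr1n mulr1 coefXn.
rewrite -natr_sum natz -sum1dep_card [in RHS]big_mkcondr /=.
by congr Posz; apply: eq_bigr => S _; rewrite eq_sym; case: eqP.
Qed.

(** Since [S] is closed under [e], a path of the whole graph that starts in [S] never leaves it, so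
    it lifts to the subtype one vertex at a time. *)
Lemma path_connect_induced {T : finType} {e : rel T} {S : {set T}}
    {p : seq T} {u v : {x | x \in S}} :
  (forall x y, x \in S -> e x y -> y \in S) ->
  path e (val u) p -> val v = last (val u) p ->
  connect (induced_graph e S) u v.
Proof.
move=> closedS; elim: p u => [|x p IHp] u /=; first by move=> _ /val_inj->.
case/andP=> eux px def_v; have xS := closedS _ _ (valP u) eux.
apply: (connect_trans (connect1 _)) (IHp (exist _ x xS) px def_v).
exact: eux.
Qed.

Lemma induced_connect {T : finType} {e : rel T} {S : {set T}}
    {u v : {x | x \in S}} :
  connect (induced_graph e S) u v -> connect e (val u) (val v).
Proof.
case/connectP=> p pth ->; apply/connectP.
by exists (map val p); rewrite ?last_map // path_map.
Qed.

Lemma mem_components {T : finType} (e : rel T) (x : T) :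
  [set y | connect e x y] \in components e.
Proof. by apply/imsetP; exists x => //; apply/setP=> y; rewrite !inE. Qed.

(** Two members are joined in [e] through the base point [x], by symmetry; the joining path lifts to
    the component because the latter is closed under [e]. *)
Lemma component_connected {T : finType} {e : rel T} {C : {set T}} :
  symmetric e -> C \in components e -> connected_set e C.
Proof.
move=> e_sym /imsetP[x _ ->]; set D := [set y in _ | _].
have xD : x \in D by rewrite !inE connect0.
apply/and3P; split; first by apply/set0Pn; exists x.
  by apply/card_gt0P; exists (exist _ x xD).
apply/forallP=> u; apply/forallP=> v.
have: connect e (val u) (val v).
  have := valP v; have := valP u; rewrite !inE /= (sym_connect_sym e_sym).
  exact: connect_trans.
case/connectP=> p pth def_v; apply: path_connect_induced pth def_v => y z.
by rewrite !inE /= => xy /connect1; apply: connect_trans.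
Qed.

(** The component of any vertex of [S] will do, as paths of the induced graph are paths of [e]. *)
Lemma connected_sub_component {T : finType} {e : rel T} {S : {set T}} :
  connected_set e S -> exists2 C, C \in components e & S \subset C.
Proof.
case/and3P=> /set0Pn[x xS] _ /forallP conS.
exists [set y | connect e x y]; first exact: mem_components.
apply/subsetP=> y yS; rewrite inE.
exact: induced_connect (forallP (conS (exist _ x xS)) (exist _ y yS)).
Qed.

Theorem proposition13 (T : finType) (e : rel T)
    (e_sym : symmetric e) (e_irr : irreflexive e) (T_gt0 : (0 < #|T|)%N) :
  let c := (size (da_x1 e)).-1 in
  (\max_(C in components e) #|C| = c)%N /\
  (#|[set C in components e | #|C| == c]|)%:Z = (da_x1 e)`_c.
Proof.
move=> c; set m := (\max_(C in components e) #|C|)%N.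
have le_m S : connected_set e S -> (#|S| <= m)%N.
  case/connected_sub_component=> C compC /subset_leq_card/leq_trans; apply.
  exact: (@leq_bigmax_cond _ (mem (components e)) (fun C => #|C|)).
(* A vertex provides a component, so the maximum [m] is attained by some [C0] and is not just the
   default 0 of an empty [\max]. *)
have [x _] := card_gt0P T_gt0.
have comp_gt0 : (0 < #|components e|)%N.
  by apply/card_gt0P; exists [set y | connect e x y]; apply: mem_components.
have [C0 compC0 card_C0] := eq_bigmax_cond (fun C : {set T} => #|C|) comp_gt0.
have coef_m : (da_x1 e)`_m = (#|[set C in components e | #|C| == m]|)%:Z.
  rewrite coef_da_x1; congr (Posz #|pred_of_set _|).
  apply/setP=> S; rewrite !inE; case: eqP => [card_S|]; rewrite ?andbF // !andbT.
  apply/idP/idP=> [conS|]; last exact: component_connected.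
  (* The component around [S] has at most [m = #|S|] vertices, so the inclusion is an equality. *)
  have [C compC sSC] := connected_sub_component conS.
  suff /eqP-> : S == C by [].
  by rewrite eqEcard sSC card_S le_m // component_connected.
have c_m : c = m.
  apply/eqP; rewrite eqn_leq; apply/andP; split.
    (* Upper bound: every coefficient beyond [m] counts an empty family. *)
    rewrite /c -subn1 leq_subLR add1n; apply/leq_sizeP=> k lt_mk.
    rewrite coef_da_x1 [X in #|pred_of_set X|](_ : _ = set0) ?cards0 //.
    apply/setP=> S; rewrite !inE; apply/negbTE/andP=> -[/le_m le_Sm /eqP card_S].
    by rewrite -card_S ltnNge le_Sm in lt_mk.
  (* Lower bound: were the size at most [m], the coefficient at [m] would vanish, yet it counts
     [C0]. The strict inequality also keeps the predecessor in [c] from truncating at 0. *)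
  suff: (m < size (da_x1 e))%N by rewrite /c; case: size.
  rewrite ltnNge; apply/negP=> /leq_sizeP/(_ m (leqnn m))/eqP.
  rewrite coef_m; apply/negP; rewrite -lt0n; apply/card_gt0P; exists C0.
  by rewrite inE compC0 -card_C0 /=.
by rewrite c_m coef_m.
Qed.
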